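(* Let $A$ denote an almost negative matrix such that one of its link matrices has a row or column consisting entirely of zeroes. Then $A$ splits as a direct sum $A=B\oplus C$.
   Context: An almost negative matrix is a symmetric real $n\times n$ matrix all of whose off-diagonal entries are non-positive. For $I\subseteq\{1,\dots,n\}$ write $A_I=(a_{ij})_{i,j\in I}$. Link matrix: let $I\subseteq\{1,\dots,n\}$ be such that $A_I$ is positive definite, let $e_i$ be the $i$-th standard basis vector, and let $\varphi:\mathbb{R}^n\to U^\perp=\{w\in\mathbb{R}^n : w^TAe_i=0\ \forall i\in I\}$ be the orthogonal projection with respect to the symmetric bilinear form induced by $A$. With $J=\{1,\dots,n\}\setminus I$, the link matrix of $A$ with respect to $I$ is $lk(I,A)=(b_{st})_{s,t\in J}$, where $b_{st}=\varphi(e_s)^TA\varphi(e_t)$. $A$ splits as a direct sum $A=B\oplus C$ if, after a permutation of indices, $A$ is the block matrix $\begin{pmatrix}B&0\\0&C\end{pmatrix}$.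
   Formalization: B is always nonempty, but C is claimed nonempty only when the link matrix has order at least 2; for a 1×1 zero link matrix a nontrivial splitting can fail, e.g. A = (1 -1; -1 1) with I = {1}, or A = (0) with I empty. *)

(* Defs.v *)
From HB Require Import structures.
From mathcomp Require Import all_boot all_order all_algebra.
From mathcomp Require Import reals.

Set Implicit Arguments.
Unset Strict Implicit.
Unset Printing Implicit Defensive.

Import Order.TTheory GRing.Theory Num.Theory.
Local Open Scope ring_scope.

(* Vectors are row vectors, as usual in MathComp: the bilinear form induced by
   A is bform A v w = v A w^T, and linear maps act by right multiplication. *)

Definition almost_negative (R : realType) (n : nat) (A : 'M[R]_n) : Prop :=
  A^T = A /\ forall i j : 'I_n, i != j -> A i j <= 0.

Definition bform (R : realType) (n : nat) (A : 'M[R]_n) (v w : 'rV[R]_n) : R :=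
  (v *m A *m w^T) 0 0.

Definition positive_definite (R : realType) (n : nat) (A : 'M[R]_n) : Prop :=
  A^T = A /\ forall v : 'rV[R]_n, v != 0 -> 0 < bform A v v.

Definition basis_vec (R : realType) (n : nat) (i : 'I_n) : 'rV[R]_n :=
  delta_mx 0 i.

(* A_I: the elements of I are listed in increasing order by enum_val. *)
Definition principal_submx (R : realType) (n : nat) (I : {set 'I_n})
    (A : 'M[R]_n) : 'M[R]_#|I| :=
  \matrix_(k < #|I|, l < #|I|) A (enum_val k) (enum_val l).

Definition span_basis (R : realType) (n : nat) (I : {set 'I_n}) : 'M[R]_n :=
  (\sum_(i in I) <<basis_vec R i>>)%MS.

(* The row space of this matrix is {w | w A e_i^T = 0 for all i in I}. *)
Definition span_basis_perp (R : realType) (n : nat) (I : {set 'I_n})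
    (A : 'M[R]_n) : 'M[R]_n :=
  (\bigcap_(i in I) kermx (A *m (basis_vec R i)^T))%MS.

(* The A-orthogonal projection onto U^perp, where U is spanned by the e_i with
   i in I.  When A_I is positive definite, R^n is the direct sum of U and
   U^perp (even if A is degenerate), and this is the projection onto U^perp
   parallel to U. *)
Definition perp_proj (R : realType) (n : nat) (I : {set 'I_n})
    (A : 'M[R]_n) (v : 'rV[R]_n) : 'rV[R]_n :=
  v *m proj_mx (span_basis_perp I A) (span_basis R I).

(* lk(I, A); only meaningful when A_I is positive definite. *)
Definition link_matrix (R : realType) (n : nat) (I : {set 'I_n})
    (A : 'M[R]_n) : 'M[R]_#|~: I| :=
  \matrix_(s < #|~: I|, t < #|~: I|)
    bform A (perp_proj I A (basis_vec R (enum_val s)))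
            (perp_proj I A (basis_vec R (enum_val t))).

(* A = B (+) C after the relabelling f of the indices; bijectivity of f forces
   p + q = n.  The blocks may be empty (p = 0 or q = 0). *)
Definition is_direct_sum (R : realType) (n p q : nat)
    (A : 'M[R]_n) (B : 'M[R]_p) (C : 'M[R]_q) : Prop :=
  exists2 f : 'I_(p + q) -> 'I_n,
    bijective f & mxsub f f A = block_mx B 0 0 C.

(* Main.v *)
Require Import Defs.
From mathcomp Require Import all_boot all_order all_algebra.
From mathcomp Require Import reals.

Set Implicit Arguments.
Unset Strict Implicit.
Unset Printing Implicit Defensive.

Import Order.TTheory GRing.Theory Num.Theory.
Local Open Scope ring_scope.

(* If the row of lk(I, A) indexed by s vanishes, then w = phi(e_s) is
   A-orthogonal both to U and to its complement U^perp, so w A = 0.  Outside I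
   the coordinates of w are those of e_s, and since A_I is positive definite
   with nonpositive off-diagonal entries, the other ones are nonnegative.  For j outside the support P of w, the
   j-th entry of w A = 0 is a sum of nonpositive terms, so they all vanish:
   A i j = 0 for i in P, and A splits along P and its complement. *)

Lemma bformE (R : realType) (n : nat) (A : 'M[R]_n) (v w : 'rV[R]_n) :
  bform A v w = \sum_j (v *m A) 0 j * w 0 j.
Proof. by rewrite /bform mxE; apply: eq_bigr => j _; rewrite [w^T _ _]mxE. Qed.

Lemma bformE2 (R : realType) (n : nat) (A : 'M[R]_n) (v w : 'rV[R]_n) :
  bform A v w = \sum_j \sum_i v 0 i * A i j * w 0 j.
Proof. by rewrite bformE; apply: eq_bigr => j _; rewrite mxE mulr_suml. Qed.

Lemma bform_sym (R : realType) (n : nat) (A : 'M[R]_n) (v w : 'rV[R]_n) :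
  A^T = A -> bform A v w = bform A w v.
Proof.
move=> symA; rewrite /bform -!trace_mx11 -mxtrace_tr.
by rewrite !trmx_mul trmxK symA mulmxA.
Qed.

Lemma mulmx_basis_vecT (R : realType) (n : nat) (v : 'rV[R]_n) (j : 'I_n) :
  v *m (basis_vec R j)^T = (v 0 j)%:M.
Proof.
by rewrite /basis_vec trmx_delta -colE; apply/matrixP => a b;
   rewrite !ord1 !mxE eqxx mulr1n.
Qed.

Lemma sub_span_basis_perpP (R : realType) (n : nat) (A : 'M[R]_n)
    (I : {set 'I_n}) (w : 'rV[R]_n) :
  reflect {in I, forall i, (w *m A) 0 i = 0} (w <= span_basis_perp I A)%MS.
Proof.
apply: (iffP sub_bigcapmxP) => perp i iI.
  have /sub_kermxP := perp i iI.
  by rewrite mulmxA mulmx_basis_vecT => /matrixP/(_ 0 0); rewrite !mxE.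
by apply/sub_kermxP; rewrite mulmxA mulmx_basis_vecT perp // raddf0.
Qed.

Lemma span_basis_out (R : realType) (n : nat) (I : {set 'I_n})
    (x : 'rV[R]_n) (j : 'I_n) :
  (x <= Defs.span_basis R I)%MS -> j \notin I -> x 0 j = 0.
Proof.
move=> xI jI; have /sub_kermxP : (x <= kermx (basis_vec R j)^T)%MS.
  apply: (submx_trans xI); apply/sumsmx_subP => i iI.
  rewrite genmxE; apply/sub_kermxP; rewrite mulmx_basis_vecT mxE eqxx.
  by case: eqVneq jI => [->|_ _]; rewrite ?iI //= raddf0.
by rewrite mulmx_basis_vecT => /matrixP/(_ 0 0); rewrite !mxE.
Qed.

(** Right multiplication by the transpose restricts a row vector to its coordinates in [I]; right
    multiplication by the matrix itself extends by zero. *)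
Definition basis_mx (R : realType) (n : nat) (I : {set 'I_n}) :
    'M[R]_(#|I|, n) := rowsub enum_val 1%:M.

Lemma mulmx_basis_mxT (R : realType) (m n : nat) (I : {set 'I_n})
    (M : 'M[R]_(m, n)) :
  M *m (basis_mx R I)^T = colsub enum_val M.
Proof. by rewrite /basis_mx trmx_mxsub trmx1 mulmx_colsub mulmx1. Qed.

Lemma principal_submxE (R : realType) (n : nat) (I : {set 'I_n})
    (A : 'M[R]_n) :
  principal_submx I A = basis_mx R I *m A *m (basis_mx R I)^T.
Proof.
rewrite mulmx_basis_mxT mul_rowsub_mx mul1mx.
by apply/matrixP => k l; rewrite !mxE.
Qed.

Lemma basis_mx_sub (R : realType) (n : nat) (I : {set 'I_n}) :
  (basis_mx R I <= Defs.span_basis R I)%MS.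
Proof.
apply/row_subP => k; rewrite /basis_mx row_rowsub rowE mulmx1.
by apply: (sumsmx_sup (enum_val k)); rewrite ?enum_valP // genmxE.
Qed.

Lemma basis_mxK (R : realType) (n : nat) (I : {set 'I_n}) (v : 'rV[R]_n) :
  (forall j, j \notin I -> v 0 j = 0) ->
  v *m (basis_mx R I)^T *m basis_mx R I = v.
Proof.
move=> vI; rewrite mulmx_basis_mxT; apply/rowP => j; rewrite mxE.
under eq_bigr do rewrite !mxE.
have [jI|jI] := boolP (j \in I); last first.
  rewrite vI // big1 // => k _.
  by case: eqVneq jI => [<-|_ _]; rewrite ?enum_valP ?mulr0.
rewrite (bigD1 (enum_rank_in jI j)) //= enum_rankK_in // eqxx mulr1.
rewrite big1 ?addr0 // => k; rewrite -(inj_eq enum_val_inj) enum_rankK_in //.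
by move/negPf->; rewrite mulr0.
Qed.

Lemma positive_definite_unitmx (R : realType) (n : nat) (A : 'M[R]_n) :
  positive_definite A -> A \in unitmx.
Proof.
case=> _ pdA; rewrite -row_free_unit -kermx_eq0; apply/rowV0P => v.
move/sub_kermxP => vA; apply/eqP; apply: contraT => /pdA.
by rewrite /bform vA mul0mx mxE ltxx.
Qed.

(** A vector supported in [I] is the extension by zero of its restriction to [I], so the form takes
    on it the value of $A_I$ on that restriction. *)
Lemma positive_definite_principal (R : realType) (n : nat) (A : 'M[R]_n)
    (I : {set 'I_n}) (v : 'rV[R]_n) :
  positive_definite (principal_submx I A) ->
  (forall j, j \notin I -> v 0 j = 0) -> bform A v v <= 0 -> v = 0.
Proof.
case=> _ pdA vI; have vK := basis_mxK vI; apply: contraTeq => v0.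
rewrite -ltNge -{1 2}vK; have := pdA (v *m (basis_mx R I)^T).
rewrite /bform principal_submxE !trmx_mul !mulmxA; apply.
by apply: contraNneq v0 => v0; rewrite -vK v0 mul0mx.
Qed.

(* The component of v in U is v A E^T (E A E^T)^-1 E, where the rows of E are
   the e_i, i in I, and E A E^T = A_I. *)
Lemma span_basis_perp_full (R : realType) (n : nat) (A : 'M[R]_n)
    (I : {set 'I_n}) (v : 'rV[R]_n) :
  positive_definite (principal_submx I A) ->
  (v <= span_basis_perp I A + Defs.span_basis R I)%MS.
Proof.
move=> /positive_definite_unitmx uA; set E := basis_mx R I.
pose u := v *m A *m E^T *m invmx (principal_submx I A) *m E.
rewrite -(subrK u v) addmx_sub_adds //; last first.
  exact: submx_trans (submxMl _ _) (basis_mx_sub R I).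
apply/sub_span_basis_perpP => i iI.
(* In [u *m A *m E^T] the factor $E A E^T = A_I$ appears and cancels the inverse in [u]. *)
have : (v - u) *m A *m E^T = 0.
  rewrite !mulmxBl /u -!(mulmxA _ E) -(mulmxA _ (E *m A)) -principal_submxE.
  by rewrite mulmxKV ?subrr.
rewrite mulmx_basis_mxT => /rowP/(_ (enum_rank_in iI i)).
by rewrite [LHS]mxE [RHS]mxE enum_rankK_in.
Qed.

Lemma perp_proj_perp (R : realType) (n : nat) (A : 'M[R]_n) (I : {set 'I_n})
    (v : 'rV[R]_n) :
  {in I, forall i, (perp_proj I A v *m A) 0 i = 0}.
Proof. by apply/sub_span_basis_perpP; apply: proj_mx_sub. Qed.

(** Since $U^\perp + U$ is the whole space, [v] minus its projection lies in $U$, which has no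
    coordinates outside [I]. *)
Lemma perp_proj_out (R : realType) (n : nat) (A : 'M[R]_n) (I : {set 'I_n})
    (v : 'rV[R]_n) (j : 'I_n) :
  positive_definite (principal_submx I A) -> j \notin I ->
  perp_proj I A v 0 j = v 0 j.
Proof.
move=> pdI jI; apply/esym/eqP; rewrite -subr_eq0; apply/eqP.
have := proj_mx_compl_sub (span_basis_perp_full v pdI).
by move=> /span_basis_out/(_ jI); rewrite !mxE.
Qed.

(** The vector [v] and its projection differ only at coordinates in [I], exactly where $\varphi(u)
    A$ vanishes. *)
Lemma bform_perp_proj (R : realType) (n : nat) (A : 'M[R]_n) (I : {set 'I_n})
    (u v : 'rV[R]_n) :
  positive_definite (principal_submx I A) ->
  bform A (perp_proj I A u) (perp_proj I A v) = bform A (perp_proj I A u) v.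
Proof.
move=> pdI; rewrite !bformE; apply: eq_bigr => j _.
have [jI|jI] := boolP (j \in I); last by rewrite (perp_proj_out v pdI jI).
by rewrite perp_proj_perp ?mul0r.
Qed.

Lemma link_matrix_sym (R : realType) (n : nat) (A : 'M[R]_n) (I : {set 'I_n}) :
  A^T = A -> (link_matrix I A)^T = link_matrix I A.
Proof. by move=> symA; apply/matrixP => s t; rewrite !mxE bform_sym. Qed.

(** For [j] outside [I], dropping the second projection turns the link entry at $(s, j)$ into entry
    [j] of $\varphi(e_s) A$; the entries in [I] vanish by orthogonality. *)
Lemma link_row0_radical (R : realType) (n : nat) (A : 'M[R]_n)
    (I : {set 'I_n}) (s : 'I_#|~: I|) :
  positive_definite (principal_submx I A) ->
  row s (link_matrix I A) = 0 ->
  perp_proj I A (basis_vec R (enum_val s)) *m A = 0.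
Proof.
move=> pdI row0; apply/rowP => j; rewrite [RHS]mxE.
have [jI|jI] := boolP (j \in I); first exact: perp_proj_perp.
have jC : j \in ~: I by rewrite inE.
move/rowP/(_ (enum_rank_in jC j)): row0.
rewrite mxE mxE [RHS]mxE bform_perp_proj // enum_rankK_in //.
by rewrite /bform mulmx_basis_vecT mxE.
Qed.

(* For the negative part v of w, the sum p = w + v is nonnegative with support
   disjoint from that of v, so that 0 = w A v^T = p A v^T - v A v^T with
   p A v^T <= 0. *)
Lemma radical_ge0 (R : realType) (n : nat) (A : 'M[R]_n) (I : {set 'I_n})
    (w : 'rV[R]_n) :
  almost_negative A -> positive_definite (principal_submx I A) ->
  w *m A = 0 -> (forall j, j \notin I -> 0 <= w 0 j) ->
  forall j, 0 <= w 0 j.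
Proof.
move=> [_ negA] pdI wA w_ge0.
pose v : 'rV[R]_n := \row_j Num.max 0 (- w 0 j).
suff v0 : v = 0.
  move=> j; have /rowP/(_ j) := v0.
  by rewrite !mxE => /max_idPl; rewrite oppr_le0.
apply: (positive_definite_principal pdI) => [j /w_ge0 wj|].
  by rewrite mxE; apply/max_idPl; rewrite oppr_le0.
have -> : bform A v v = bform A (w + v) v.
  by rewrite /bform mulmxDl wA add0r.
rewrite bformE2; apply: sumr_le0 => j _; apply: sumr_le0 => i _.
(* A diagonal entry of [A] may be positive, but there one of the two factors around it is zero. *)
rewrite !mxE; have [->|ij] := eqVneq i j.
  by case: (leP 0 (- w 0 j)) => _; rewrite ?subrr ?mul0r ?mulr0.
rewrite mulr_le0_ge0 ?le_max ?lexx // mulr_ge0_le0 ?negA //.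
by rewrite addrC -lerBlDr sub0r le_max lexx orbT.
Qed.

Lemma radical_support_split (R : realType) (n : nat) (A : 'M[R]_n)
    (w : 'rV[R]_n) (i j : 'I_n) :
  almost_negative A -> w *m A = 0 -> (forall k, 0 <= w 0 k) ->
  0 < w 0 i -> w 0 j = 0 -> A i j = 0.
Proof.
move=> [_ negA] wA w_ge0 wi wj.
have /rowP/(_ j) := wA; rewrite !mxE => /eqP.
rewrite -oppr_eq0 -sumrN psumr_eq0 => [/allP/(_ i)|k _].
  by rewrite mem_index_enum oppr_eq0 mulf_eq0 gt_eqF //= => /(_ isT)/eqP.
(* The sign of [A j j] is not controlled, but its coefficient [w 0 j] is zero. *)
have [->|kj] := eqVneq k j; first by rewrite wj mul0r oppr0.
by rewrite oppr_ge0 mulr_ge0_le0 ?negA.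
Qed.

Lemma is_direct_sum_set (R : realType) (n : nat) (A : 'M[R]_n)
    (P : {set 'I_n}) :
  A^T = A -> (forall i j, i \in P -> j \notin P -> A i j = 0) ->
  is_direct_sum A (principal_submx P A) (principal_submx (~: P) A).
Proof.
move=> symA A0.
pose f (k : 'I_(#|P| + #|~: P|)) : 'I_n :=
  match split k with inl a => enum_val a | inr b => enum_val b end.
have fl a : f (lshift _ a) = enum_val a.
  by rewrite /f -[lshift _ a]/(unsplit (inl a)) unsplitK.
have fr b : f (rshift _ b) = enum_val b.
  by rewrite /f -[rshift _ b]/(unsplit (inr b)) unsplitK.
have inC (b : 'I_#|~: P|) : enum_val b \notin P.
  by have := enum_valP b; rewrite inE.
exists f.
  apply: inj_card_bij; last by rewrite !card_ord cardsC card_ord.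
  move=> k l; rewrite -(splitK k) -(splitK l).
  case: (split k) => a; case: (split l) => b; rewrite /= ?fl ?fr.
  - by move/enum_val_inj->.
  - by move=> ab; have := inC b; rewrite -ab enum_valP.
  - by move=> ab; have := inC a; rewrite ab enum_valP.
  - by move/enum_val_inj->.
rewrite -[LHS]submxK; congr block_mx; apply/matrixP => a b;
  rewrite !mxE ?fl ?fr //.
- by rewrite A0 ?enum_valP.
(* The lower left block is the transpose of the upper right one. *)
- by rewrite -symA mxE A0 ?enum_valP.
Qed.

(* B is never empty.  C is nonempty as soon as the link matrix has order at
   least 2; for order 1 this can fail: A = (0) with I empty, or
   A = (1 -1; -1 1) with I a singleton, has link matrix (0) but admits no
   decomposition into two nonempty blocks. *)
Theorem lemmaB (R : realType) (n : nat) (A : 'M[R]_n) (I : {set 'I_n})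
    (hA : almost_negative A)
    (hI : positive_definite (principal_submx I A))
    (hzero : (exists s : 'I_#|~: I|, row s (link_matrix I A) = 0) \/
             (exists t : 'I_#|~: I|, col t (link_matrix I A) = 0)) :
  exists (p q : nat) (B : 'M[R]_p) (C : 'M[R]_q),
    [/\ is_direct_sum A B C, (0 < p)%N & (1 < #|~: I|)%N -> (0 < q)%N].
Proof.
have symA := hA.1.
have [s /(link_row0_radical hI) wA] : exists s, row s (link_matrix I A) = 0.
  case: hzero => // -[t col0]; exists t.
  by rewrite -(link_matrix_sym I symA) -tr_col col0 trmx0.
set w := perp_proj I A _ in wA.
have wE j : j \notin I -> w 0 j = (j == enum_val s)%:R.
  by move=> jI; rewrite (perp_proj_out _ hI jI) mxE.
have w_ge0 : forall j, 0 <= w 0 j.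
  by apply: (radical_ge0 hA hI wA) => j /wE->.
have sI : enum_val s \notin I by have := enum_valP s; rewrite inE.
(* Outside [I], the set [P] contains only the index of [s], where [w] is 1. *)
pose P := [set i | 0 < w 0 i].
exists #|P|, #|~: P|, (principal_submx P A), (principal_submx (~: P) A).
split.
- apply: is_direct_sum_set => // i j; rewrite !inE => wi wj.
  apply: (radical_support_split hA wA w_ge0 wi); apply/eqP.
  by rewrite eq_le w_ge0 leNgt wj.
- by apply/card_gt0P; exists (enum_val s); rewrite inE wE // eqxx ltr01.
(* A second index outside [I] has [w] equal to 0 and so lies in the complement of [P]. *)
- rewrite (cardD1 (enum_val s)) enum_valP ltnS => /card_gt0P[t].
  rewrite !inE => /andP[ts tI]; apply/card_gt0P; exists t.
  by rewrite !inE wE // (negPf ts) ltxx.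
Qed.
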